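(* Let $m,n \geq 1$ be integers. Then \[ \gamma(H_{m,n}) \leq \begin{cases} \frac{9}{4}mn & \text{if } n \equiv 0 \pmod 4,\\ \frac{9}{4}m(n-1) +3m & \text{if } n \equiv 1 \pmod 4,\\ \frac{9}{4}m(n-2) +5m & \text{if } n \equiv 2 \pmod 4,\\ \frac{9}{4}m(n-3) + 7m & \text{if } n \equiv 3 \pmod 4. \end{cases}\]
   Context: The infinite truncated square tiling graph $H_{\infty,\infty}$ has vertex set $\{(a,(x,y)) : a\in\mathbb{Z}_4,\ (x,y)\in\mathbb{Z}^2\}$. Its edges are: $(a,(x,y))\sim(a+1,(x,y))$ with $a+1$ taken modulo 4 (so each $(x,y)$ carries a 4-cycle whose vertices $0,1,2,3$ are its top, right, bottom, left vertices); $(1,(x,y))\sim(3,(x+1,y))$; and $(0,(x,y))\sim(2,(x,y+1))$. For $(x,y)\in\mathbb{Z}^2$ the octagon $O_{x,y}$ is the 8-cycle through $(0,(x,y)),(1,(x,y)),(3,(x+1,y)),(0,(x+1,y)),(2,(x+1,y+1)),(3,(x+1,y+1)),(1,(x,y+1)),(2,(x,y+1))$, in this cyclic order. For positive integers $m,n$, $H_{m,n}$ is the finite subgraph consisting of $m$ rows of $n$ octagons each: the union of the octagons $O_{x,y}$ with $0\le x\le n-1$, $0\le y\le m-1$. $\gamma(G)$ denotes the domination number of a finite graph $G$: the smallest cardinality of a set $T$ of vertices such that every vertex of $G$ is in $T$ or adjacent to a vertex of $T$. *)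

(* Defs.v *)
From mathcomp Require Import all_boot all_order all_algebra.

Set Implicit Arguments.
Unset Strict Implicit.
Unset Printing Implicit Defensive.

Import Order.TTheory GRing.Theory Num.Theory.

Local Open Scope ring_scope.

Record sgraph := SGraph {
  vertex :> finType;
  adj : rel vertex;
  adj_sym : symmetric adj;
  adj_irrefl : irreflexive adj }.

Definition dominating (G : sgraph) (D : {set G}) : bool :=
  [forall v, (v \in D) || [exists u in D, adj u v]].

(* The full vertex set is dominating, so the minimum is well defined. *)
Definition domination_number (G : sgraph) : nat :=
  #|[arg min_(D < [set: G] | dominating D) #|D| ]|%N.

(* (a, (x, y)): the residues 0, 1, 2, 3 are the top, right, bottom and left
   corners of the square placed at (x, y). *)
Notation tiling_vertex := ('Z_4 * (int * int))%type.

Definition tiling_arc : rel tiling_vertex := fun u v =>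
  let: (a, (x, y)) := u in
  let: (b, (x', y')) := v in
  [|| [&& b == a + 1, x' == x & y' == y],
      [&& a == 1, b == 3, x' == x + 1 & y' == y]
    | [&& a == 0, b == 2, x' == x & y' == y + 1]].

Definition tiling_adj : rel tiling_vertex :=
  fun u v => tiling_arc u v || tiling_arc v u.

Definition octagon (x y : int) : seq tiling_vertex :=
  [:: (0, (x, y)); (1, (x, y));
      (3, (x + 1, y)); (0, (x + 1, y));
      (2, (x + 1, y + 1)); (3, (x + 1, y + 1));
      (1, (x, y + 1)); (2, (x, y + 1))].

(* Adjacency along the closed walk c; [next] wraps around at the end of c. *)
Definition cycle_adj (T : eqType) (c : seq T) : rel T := fun u v =>
  (u \in c) && (v == next c u) || (v \in c) && (u == next c v).

(* m rows of n octagons: x (column) ranges below n and y (row) below m. *)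
Definition octagons (m n : nat) : seq (seq tiling_vertex) :=
  [seq octagon x%:Z y%:Z | y <- iota 0 m, x <- iota 0 n].

Lemma tiling_adj_irrefl : irreflexive tiling_adj.
Proof.
move=> [a [x y]]; rewrite /tiling_adj /tiling_arc orbb.
by case: a => -[|[|[|[|//]]]] ? /=; rewrite ?andbF.
Qed.

Lemma octagon_ucycle (x y : int) : ucycle tiling_adj (octagon x y).
Proof.
have nx (z : int) : (z == z + 1) = false.
  by rewrite -[X in X == _]addr0 (inj_eq (addrI z)).
have nx' (z : int) : (z + 1 == z) = false by rewrite eq_sym nx.
apply/andP; split.
  by rewrite /= /tiling_adj /tiling_arc !eqxx /= ?orbT.
by rewrite /= !inE !xpair_eqE ?nx ?nx' ?andbF.
Qed.

Lemma octagonsP m n c :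
  reflect (exists x y : nat, [/\ (x < n)%N, (y < m)%N & c = octagon x%:Z y%:Z])
          (c \in octagons m n).
Proof.
apply: (iffP allpairsP) => [[[y x] /= []]|[x [y [xn ym ->]]]].
  by rewrite !mem_iota => ym xn ->; exists x, y.
by exists (y, x); rewrite !mem_iota.
Qed.

Lemma cycle_adj_tiling (x y : int) : subrel (cycle_adj (octagon x y)) tiling_adj.
Proof.
have /andP[oc _] := octagon_ucycle x y.
move=> u v; rewrite /cycle_adj => /orP[] /andP[uo /eqP->].
  exact: next_cycle oc uo.
by rewrite /tiling_adj orbC; exact: next_cycle oc uo.
Qed.

Section FiniteTiling.
Variables m n : nat.

(* H is the union of the octagons as subgraphs of the tiling: its vertices are
   those of the octagons, its edges the edges of the octagons. *)
Definition H_vertex := seq_sub (flatten (octagons m n)).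

Definition H_adj : rel H_vertex := fun u v =>
  has (fun c => cycle_adj c (val u) (val v)) (octagons m n).

Lemma H_adj_sym : symmetric H_adj.
Proof. by move=> u v; apply: eq_has => c; rewrite /cycle_adj orbC. Qed.

Lemma H_adj_irrefl : irreflexive H_adj.
Proof.
move=> u; apply/negP => /hasP[c /octagonsP[x [y [_ _ ->]]]].
by move/cycle_adj_tiling; rewrite tiling_adj_irrefl.
Qed.

Lemma H_adj_tiling (u v : H_vertex) : H_adj u v -> tiling_adj (val u) (val v).
Proof. by move=> /hasP[c /octagonsP[x [y [_ _ ->]]]] /cycle_adj_tiling. Qed.

Definition H : sgraph := SGraph H_adj_sym H_adj_irrefl.

End FiniteTiling.

(* Main.v *)
Require Import Defs.
From mathcomp Require Import all_boot all_order all_algebra.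
From mathcomp Require Import zify lra.

Import Order.TTheory GRing.Theory Num.Theory.

Local Open Scope ring_scope.

(** Every third vertex of an 8-cycle, namely those number 0, 3 and 6, dominates
    it ([cycle_dominated_by_thirds]).  In the octagon O_{x,y} these are the top
    of the square (x, y), the top of the square (x + 1, y) and the right corner
    of the square (x, y + 1).  Every vertex of H_{m,n} lies on some octagon, so
    the vertices picked in this way from all the octagons dominate H_{m,n}.

    The choice is economical because horizontally adjacent octagons share a
    pick: the top of the square (x + 1, y) is vertex 3 of O_{x,y} and vertex 0
    of O_{x+1,y}.  A row of n octagons therefore uses n + 1 tops and n right
    corners, which gives gamma(H_{m,n}) <= m (2 n + 1)
    ([domination_number_H_le]).

    This is at most each of the four bounds: if r is the residue of n modulo 4,
    taken in {1, 2, 3, 4}, then n >= r and the bound for that residue exceeds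
    m (2 n + 1) by m (n - r) / 4. *)

Lemma domination_number_le (G : sgraph) (D : {set G}) :
  dominating D -> (domination_number G <= #|D|)%N.
Proof.
move=> domD; rewrite /domination_number; case: arg_minnP => [|A _ minA].
  by apply/forallP => v; rewrite inE.
exact: minA.
Qed.

Lemma cycle_adj_sym (T : eqType) (c : seq T) : symmetric (cycle_adj c).
Proof. by move=> u v; rewrite /cycle_adj orbC. Qed.

Lemma cycle_adj_nth (T : eqType) (x0 : T) (c : seq T) (i : nat) :
  uniq c -> (i.+1 < size c)%N -> cycle_adj c (nth x0 c i) (nth x0 c i.+1).
Proof.
move=> c_uniq lt_i; have lt_i' := ltnW lt_i.
apply/orP; left; rewrite mem_nth //= next_nth mem_nth // index_uniq //.
case: c lt_i {c_uniq lt_i'} => // y c lt_i /=.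
by apply/eqP/set_nth_default.
Qed.

(** A vertex at position k of the cycle is dominated by the one at the multiple
    of 3 nearest to k, which is at distance at most 1.  The condition on the
    length rules out the one failure: for k the last position and k + 1
    divisible by 3, that multiple would be k + 1, past the end of the cycle. *)
Lemma cycle_dominated_by_thirds (T : eqType) (c : seq T) (v : T) :
  uniq c -> ~~ (3 %| size c)%N -> v \in c ->
  exists2 i, (3 * i < size c)%N
    & (nth v c (3 * i)%N == v) || cycle_adj c (nth v c (3 * i)%N) v.
Proof.
move=> c_uniq size_c /(nthP v)[k lt_k def_v].
set i := (k.+1 %/ 3)%N; have lt_i : (3 * i < size c)%N by lia.
exists i => //; rewrite -[in X in _ == X]def_v -[X in cycle_adj _ _ X]def_v.
have [->|[def_k|def_i]] :
    (3 * i = k \/ k = (3 * i).+1 \/ 3 * i = k.+1)%N by lia.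
- by rewrite eqxx.
- by rewrite def_k cycle_adj_nth ?orbT // -def_k.
- by rewrite def_i cycle_adj_sym cycle_adj_nth ?orbT // -def_i.
Qed.

Definition octagon_picks (x y : int) : seq tiling_vertex :=
  [:: (0, (x, y)); (0, (x + 1, y)); (1, (x, y + 1))].

Lemma octagon_dominated (x y : int) (v : tiling_vertex) :
  v \in octagon x y ->
  exists2 u, u \in octagon_picks x y & (u == v) || cycle_adj (octagon x y) u v.
Proof.
have /andP[_ o_uniq] := octagon_ucycle x y.
move=> /(cycle_dominated_by_thirds _ _ _ o_uniq isT)[i lt_i dom_v].
exists (nth v (octagon x y) (3 * i)) => //.
have {lt_i dom_v} : (i < 3)%N by move: lt_i; rewrite /=; lia.
by case: i => [|[|[|//]]] _; rewrite !inE eqxx ?orbT.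
Qed.

Definition picks (m n : nat) : seq tiling_vertex :=
  [seq (0, (x%:Z, y%:Z)) | y <- iota 0 m, x <- iota 0 n.+1] ++
  [seq (1, (x%:Z, y%:Z + 1)) | y <- iota 0 m, x <- iota 0 n].

Lemma size_picks (m n : nat) : size (picks m n) = (m * (2 * n + 1))%N.
Proof. by rewrite size_cat !size_allpairs !size_iota; lia. Qed.

Lemma octagon_picks_sub (m n x y : nat) :
  (x < n)%N -> (y < m)%N -> {subset octagon_picks x y <= picks m n}.
Proof.
move=> lt_x lt_y u; rewrite !inE mem_cat => /or3P[] /eqP->; apply/orP.
- left; apply/allpairsP; exists (y, x).
  by split; rewrite ?mem_iota //= ltnS ltnW.
- left; apply/allpairsP; exists (y, x.+1).
  by split; rewrite ?mem_iota //= -PoszD addn1.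
- by right; apply/allpairsP; exists (y, x); split; rewrite ?mem_iota.
Qed.

Lemma domination_number_H_le (m n : nat) :
  (domination_number (H m n) <= m * (2 * n + 1))%N.
Proof.
pose D : {set H m n} := [set u : H m n | val u \in picks m n].
have domD : dominating D.
  apply/forallP => v.
  have /flattenP[c c_oct v_c] : val v \in flatten (octagons m n) by apply: valP.
  have [x [y [lt_x lt_y def_c]]] := octagonsP _ _ _ c_oct.
  rewrite {}def_c in c_oct v_c.
  have [u u_pick] := octagon_dominated _ _ _ v_c.
  have {}u_pick := octagon_picks_sub _ _ _ _ lt_x lt_y _ u_pick.
  case/orP => [/eqP def_u | adj_uv]; first by rewrite inE -def_u u_pick.
  have u_H : u \in flatten (octagons m n).
    apply/flattenP; exists (octagon x y) => //.
    by case/orP: adj_uv => /andP[] // _ /eqP->; rewrite mem_next.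
  apply/orP; right; apply/existsP; exists (SeqSub u_H : H m n).
  by rewrite inE u_pick; apply/hasP; exists (octagon x y).
apply: leq_trans (domination_number_le _ _ domD) _.
rewrite -size_picks cardE -(size_map val); apply: uniq_leq_size.
  by rewrite map_inj_uniq ?enum_uniq //; apply: val_inj.
by move=> _ /mapP[u + ->]; rewrite mem_enum inE.
Qed.

Theorem theorem2p6 (m n : nat) (m_ge1 : (1 <= m)%N) (n_ge1 : (1 <= n)%N) :
  let gamma : rat := (domination_number (H m n))%:R in
  let M : rat := m%:R in
  let N : rat := n%:R in
  [/\ n = 0 %[mod 4] -> gamma <= 9 / 4 * M * N,
      n = 1 %[mod 4] -> gamma <= 9 / 4 * M * (N - 1) + 3 * M,
      n = 2 %[mod 4] -> gamma <= 9 / 4 * M * (N - 2) + 5 * M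
    & n = 3 %[mod 4] -> gamma <= 9 / 4 * M * (N - 3) + 7 * M].
Proof.
move=> gamma M N.
have gamma_le : gamma <= M * (2 * N + 1).
  rewrite /gamma /M /N -natrM natr1 -natrM ler_nat -addn1.
  exact: domination_number_H_le.
have slack (r : nat) : (r <= n)%N -> 0 <= M * (N - r%:R).
  by move=> le_r; rewrite mulr_ge0 ?ler0n // subr_ge0 ler_nat.
split=> n_mod.
- by have := slack 4%N ltac:(lia); lra.
- by have := slack 1%N ltac:(lia); lra.
- by have := slack 2%N ltac:(lia); lra.
- by have := slack 3%N ltac:(lia); lra.
Qed.
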